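(* Let $\sigma>0$, $\eta\ge 0$, $\epsilon>0$, let $n\ge 1$ be an integer, let $X\sim\mathcal{N}(0,\sigma^2)$, and set $$B_\infty=\frac{\eta^2}{2\sigma^2}+\sqrt{\frac{2}{\pi}}\,\frac{\eta}{\sigma}+\Big(1+\frac{1}{2n\sigma^2}\Big)\epsilon .$$ Then the volume of the typical set $A_{B_\infty}^{(n)}(X)$ (the typical set for Gaussian noise perturbed by a vector of $L_\infty$ norm at most $\eta$) satisfies $$\mathrm{Vol}\big(A_{B_\infty}^{(n)}(X)\big) \leq \Big(2^{\left(\frac{\eta^2}{2\sigma^2}+\sqrt{\frac{2}{\pi}}\frac{\eta}{\sigma}+\frac{2n\sigma^2+1}{2n\sigma^2}\epsilon\right)}\sqrt{2\pi e}\, \sigma\Big)^n .$$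
   Context: $\log$ denotes the base-2 logarithm and $f$ is the density of $X$. The differential entropy of $X$ is $h(X)=-\int_{\mathbb{R}} f(x)\log f(x)\,dx$, which equals $\log(\sqrt{2\pi e}\,\sigma)$. For $B>0$ the typical set is $$A_B^{(n)}(X)=\Big\{(x_1,\dots,x_n)\in\mathbb{R}^n:\Big|-\frac1n\log f(x_1,\dots,x_n)-h(X)\Big|\le B\Big\},$$ where $f(x_1,\dots,x_n)=\prod_{i=1}^n f(x_i)$. $\mathrm{Vol}(A)=\int_A dx_1\cdots dx_n$ is Lebesgue measure. *)

(* Defs.v *)
From HB Require Import structures.
From mathcomp Require Import all_boot all_order all_algebra.
From mathcomp Require Import all_classical all_reals all_analysis.

Set Implicit Arguments.
Unset Strict Implicit.
Unset Printing Implicit Defensive.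

Import Order.TTheory GRing.Theory Num.Theory.
Import numFieldNormedType.Exports.

Local Open Scope classical_set_scope.
Local Open Scope ring_scope.

Section cons_measure.
Local Open Scope ereal_scope.
Context d (T : measurableType d) (R : realType) (n : nat).
Variables (m1 : {sigma_finite_measure set T -> \bar R})
          (m2 : {sigma_finite_measure set (n.-tuple T) -> \bar R}).

Definition cons_pair (p : T * n.-tuple T) : n.+1.-tuple T :=
  [the n.+1.-tuple T of p.1 :: p.2].

Lemma measurable_cons_pair : measurable_fun setT cons_pair.
Proof. exact: measurable_cons. Qed.

Definition cons_measure : set (n.+1.-tuple T) -> \bar R :=
  pushforward (m1 \x m2) cons_pair.

Let cons_measure0 : cons_measure set0 = 0.
Proof. by rewrite /cons_measure /pushforward preimage_set0 measure0. Qed.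

Let cons_measure_ge0 A : 0 <= cons_measure A.
Proof. by rewrite /cons_measure /pushforward measure_ge0. Qed.

Let cons_measure_sigma_additive : semi_sigma_additive cons_measure.
Proof.
have mc := measurable_cons_pair.
move=> F mF tF mUF; rewrite /cons_measure /pushforward preimage_bigcup.
apply: measure_semi_sigma_additive.
- by move=> k; rewrite -[X in measurable X]setTI; exact: mc.
- apply/trivIsetP => /= i j _ _ ij; rewrite -preimage_setI.
  by move/trivIsetP : tF => /(_ _ _ _ _ ij) ->//; rewrite preimage_set0.
- by rewrite -preimage_bigcup -[X in measurable X]setTI; exact: mc.
Qed.

HB.instance Definition _ := isMeasure.Build _ _ _ cons_measure
  cons_measure0 cons_measure_ge0 cons_measure_sigma_additive.

Let cons_measure_sigma_finite : sigma_finite setT cons_measure.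
Proof.
have /sigma_finiteP[F [TF ndF Foo]] := sigma_finiteT m1.
have /sigma_finiteP[G [TG ndG Goo]] := sigma_finiteT m2.
have mu : measurable_fun setT
    (fun t : n.+1.-tuple T => (thead t, [tuple of behead t])).
  apply: measurable_fun_pair; last exact: measurable_behead.
  exact: (measurable_tnth ord0).
exists (fun k =>
    (fun t : n.+1.-tuple T => (thead t, [tuple of behead t])) @^-1`
      (F k `*` G k)).
  apply/seteqP; split=> // t _.
  have [i _ Fi] : (\bigcup_k F k) (thead t) by rewrite -TF.
  have [j _ Gj] : (\bigcup_k G k) [tuple of behead t] by rewrite -TG.
  exists (maxn i j) => //; split => /=.
    by move: Fi; exact/subsetPset/ndF/leq_maxl.
  by move: Gj; exact/subsetPset/ndG/leq_maxr.
move=> k; have [mFk Fky] := Foo k; have [mGk Gky] := Goo k; split.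
  by rewrite -[X in measurable X]setTI; apply: mu => //; exact: measurableX.
rewrite /cons_measure /pushforward -comp_preimage.
rewrite (_ : _ \o cons_pair = id); last first.
  by rewrite funeqE => -[x t] /=; congr (_, _); exact: val_inj.
by rewrite preimage_id product_measure1E// lte_mul_pinfty// ge0_fin_numE.
Qed.

HB.instance Definition _ := Measure_isSigmaFinite.Build _ _ _ cons_measure
  cons_measure_sigma_finite.

End cons_measure.

(* Lebesgue measure on R^n, realized as n.-tuple R: the n-fold product of the
   one-dimensional Lebesgue measure, built one coordinate at a time. *)
Fixpoint lebesgue_measure_tuple (R : realType) (n : nat) :
    {sigma_finite_measure set (n.-tuple (measurableTypeR R)) -> \bar R} :=
  match n with
  | 0 => \d_[tuple]
  | n'.+1 => cons_measure (@lebesgue_measure R) (lebesgue_measure_tuple R n')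
  end.

Lemma lebesgue_measure_tuple_box (R : realType) (n : nat)
    (A : 'I_n -> set (measurableTypeR R)) :
  (forall i, measurable (A i)) ->
  lebesgue_measure_tuple R n [set t | forall i, A i (tnth t i)] =
  (\prod_(i < n) lebesgue_measure (A i))%E.
Proof.
elim: n A => [|n IH] A mA.
  rewrite big_ord0 /= diracE mem_set//.
  by move=> [].
rewrite big_ord_recl -IH//= /cons_measure /pushforward.
rewrite -product_measure1E//; last first.
  rewrite (_ : mkset _ = \bigcap_i
     ((@tnth n (measurableTypeR R))^~ i @^-1` A (lift ord0 i))); last first.
    by apply/seteqP; split => t /= h i; [move=> _|]; apply: h.
  apply: fin_bigcap_measurable => // i _.
  by rewrite -[X in measurable X]setTI; exact: measurable_tnth.
have tnth_cons x (t : n.-tuple (measurableTypeR R)) i :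
    tnth (cons_pair (x, t)) (lift ord0 i) = tnth t i.
  by rewrite !(tnth_nth x).
congr product_measure1; apply/seteqP; split => -[x t] /=.
  move=> h; split; first exact: (h ord0).
  by move=> i; have := h (lift ord0 i); rewrite tnth_cons.
move=> [hx ht] i; have [j ->|->//] := unliftP ord0 i.
by rewrite tnth_cons.
Qed.

(* Extended base-2 logarithm: log 0 = -oo, and then 0 * log 0 = 0 holds in the
   extended reals. *)
Definition log2e (R : realType) (x : \bar R) : \bar R :=
  (lne x * ((ln 2)^-1)%:E)%E.

Definition has_density d (T : measurableType d) (R : realType)
    (P : probability T R) (X : {RV P >-> R}) (f : R -> R) : Prop :=
  [/\ measurable_fun setT f,
      forall x, 0 <= f x &
      forall A : set R, measurable A ->
        distribution P X A = (\int[lebesgue_measure]_(x in A) (f x)%:E)%E].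

Arguments has_density {d T R} P X f.

Definition differential_entropy (R : realType) (f : R -> R) : \bar R :=
  (- \int[lebesgue_measure]_x ((f x)%:E * log2e (f x)%:E))%E.

(* Points where the product density vanishes have -log f = +oo, hence
   are not typical. *)
Definition typical_set (R : realType) (f : R -> R) (n : nat) (B : R) :
    set (n.-tuple R) :=
  [set x | (`| - ((n%:R^-1)%:E * log2e (\prod_(i < n) f (tnth x i))%:E)
               - differential_entropy f | <= B%:E)%E].
Arguments typical_set {R} f n B.

(* Main.v *)
(** On the typical set the product density is at least [2^(-n (B + h(X)))],
    and it integrates to 1, so the volume is at most [2^(n (B + h(X)))]. Only
    the bound [h(X) <= log (sqrt (2 pi e) sigma)] is then needed, that is
    [E(X^2) <= sigma^2]. This second moment bound follows from the normalization
    of the Gaussian density of standard deviation [sigma / r] for [r < 1],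
    compared with that of [sigma] through [expR u >= 1 + u], by letting [r]
    tend to 1. *)
Require Import Defs.
From HB Require Import structures.
From mathcomp Require Import all_boot all_order all_algebra.
From mathcomp Require Import all_classical all_reals all_analysis.
From mathcomp Require Import measurable_realfun ring lra.

Import Order.TTheory GRing.Theory Num.Theory.
Import numFieldNormedType.Exports.

Local Open Scope classical_set_scope.
Local Open Scope ring_scope.

(** * Integration over [n]-tuples *)

(** Markov's inequality, to be applied with [A] the typical set and [g] the product density. *)
Lemma mule_measure_le_integral d (T : measurableType d) (R : realType)
    (mu : {measure set T -> \bar R}) (A : set T) (g : T -> R) (c : R) :
  measurable A -> measurable_fun setT g -> (forall x, 0 <= g x) -> 0 <= c ->
  (forall x, A x -> c <= g x) ->
  (c%:E * mu A <= \int[mu]_x (g x)%:E)%E.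
Proof.
move=> mA mg g0 c0 cg; rewrite -integral_cst//.
apply: (@le_trans _ _ (\int[mu]_(x in A) (g x)%:E)%E).
  apply: ge0_le_integral => //=.
  by apply/measurable_EFinP; apply: measurable_funTS.
apply: ge0_subset_integral => //.
- by apply/measurable_EFinP.
- by move=> x _; rewrite lee_fin.
Qed.

Lemma measurable_tuple_prod (R : realType) (f : R -> R) (n : nat) :
  measurable_fun setT f ->
  measurable_fun setT
    (fun t : n.-tuple (measurableTypeR R) => \prod_(i < n) f (tnth t i)).
Proof.
move=> mf; apply: measurable_prod => i _.
by apply: (measurableT_comp mf); exact: measurable_tnth.
Qed.

(** By induction on [n]: the measure on [n.+1]-tuples is a pushforward along [cons_pair], and
    Tonelli splits off the first coordinate. For a density [f] the value is 1. *)
Lemma integral_tuple_prod (R : realType) (f : R -> R) (n : nat) :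
  measurable_fun setT f -> (forall x, 0 <= f x) ->
  (\int[lebesgue_measure_tuple R n]_t (\prod_(i < n) f (tnth t i))%:E =
   (\int[lebesgue_measure]_x (f x)%:E) ^+ n)%E.
Proof.
move=> mf f0; have pf0 k (t : k.-tuple R) : 0 <= \prod_(i < k) f (tnth t i).
  by apply: prodr_ge0.
have mp k : measurable_fun setT (fun t : k.-tuple (measurableTypeR R) =>
    (\prod_(i < k) f (tnth t i))%:E).
  apply/measurable_EFinP; exact: measurable_tuple_prod.
elim: n => [|n IH].
  rewrite integral_dirac//= ?diracT ?big_ord0 ?mul1e//.
  exact: mp.
rewrite expeS -IH.
transitivity (\int[lebesgue_measure \x lebesgue_measure_tuple R n]_z
    (\prod_(i < n.+1) f (tnth (cons_pair z) i))%:E)%E.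
  apply: (ge0_integral_pushforward
    (@measurable_cons_pair _ (measurableTypeR R) n)) => //.
    exact: (mp n.+1).
  by move=> t _; rewrite lee_fin pf0.
rewrite fubini_tonelli1//=; first last.
- by move=> t; rewrite lee_fin pf0.
- apply: (measurableT_comp (mp n.+1)); exact: measurable_cons_pair.
rewrite /fubini_F.
have tnth_lift x (t : n.-tuple (measurableTypeR R)) i :
    tnth (cons_pair (x, t)) (lift ord0 i) = tnth t i.
  by rewrite !(tnth_nth x).
rewrite -ge0_integralZr//; first last.
- by apply: integral_ge0 => t _; rewrite lee_fin pf0.
- by move=> t _; rewrite lee_fin.
- by apply/measurable_EFinP.
apply: eq_integral => x _.
rewrite -ge0_integralZl ?lee_fin//; first last.
- by move=> t _; rewrite lee_fin pf0.
- exact: mp.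
apply: eq_integral => t _ /=; rewrite big_ord_recl EFinM.
congr ((f _)%:E * _%:E)%E; apply: eq_bigr => i _.
by rewrite tnth_lift.
Qed.

(** * Second moment of the Gaussian *)

(* Integrate [normal_pdf 0 (s / r) x >=
   r * normal_pdf 0 s x * (1 + (1 - r ^+ 2) * x ^+ 2 / (2 * s ^+ 2))]. *)
Lemma normal_second_moment_le_scale (R : realType) (s r : R) :
  0 < s -> 0 < r < 1 ->
  (\int[lebesgue_measure]_x (x ^+ 2 * normal_pdf 0 s x)%:E
   <= (2 * s ^+ 2 / (r * (1 + r)))%:E)%E.
Proof.
move=> s0 /andP[r0 r1].
(* The coefficient of [x ^+ 2 * normal_pdf 0 s x] once the lower bound is expanded. *)
pose k := r * (1 - r ^+ 2) / (2 * s ^+ 2).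
have k0 : 0 < k.
  by rewrite divr_gt0 ?mulr_gt0 ?exprn_gt0// subr_gt0 expr_lt1// ltW.
have pdf_ge x : r * normal_pdf 0 s x + k * (x ^+ 2 * normal_pdf 0 s x)
    <= normal_pdf 0 (s / r) x.
  rewrite !normal_pdfE ?gt_eqF ?divr_gt0//.
  have -> : normal_peak (s / r) = r * normal_peak s.
    rewrite /normal_peak.
    have -> : (s / r) ^+ 2 * pi *+ 2 = (r^-1) ^+ 2 * (s ^+ 2 * pi *+ 2).
      by field; exact: lt0r_neq0.
    rewrite sqrtrM ?sqr_ge0// sqrtr_sqr gtr0_norm ?invr_gt0//.
    by rewrite invfM invrK.
  have -> : normal_fun 0 (s / r) x =
      normal_fun 0 s x * expR ((1 - r ^+ 2) * x ^+ 2 / (2 * s ^+ 2)).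
    by rewrite /normal_fun -expRD; congr expR; field; rewrite !lt0r_neq0.
  have := expR_ge1Dx ((1 - r ^+ 2) * x ^+ 2 / (2 * s ^+ 2)).
  set E := expR _ => hE.
  have -> : r * (normal_peak s * normal_fun 0 s x) +
      k * (x ^+ 2 * (normal_peak s * normal_fun 0 s x)) =
      r * normal_peak s * (normal_fun 0 s x *
        (1 + (1 - r ^+ 2) * x ^+ 2 / (2 * s ^+ 2))).
    by rewrite /k; field; exact: lt0r_neq0.
  rewrite ler_pM2l; last first.
    by rewrite mulr_gt0// normal_peak_gt0// gt_eqF.
  by rewrite ler_wpM2l// normal_fun_ge0.
have mx2 : measurable_fun setT (fun x : R => x ^+ 2 * normal_pdf 0 s x).
  apply: measurable_funM; first exact: measurable_funX.
  exact: measurable_normal_pdf.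
have mp := @measurable_normal_pdf R 0 s.
have mr : measurable_fun setT
    (fun x : measurableTypeR R => (normal_pdf 0 (s / r) x)%:E).
  apply/measurable_EFinP; exact: measurable_normal_pdf.
have x2_ge0 x : 0 <= x ^+ 2 * normal_pdf 0 s x.
  by rewrite mulr_ge0 ?sqr_ge0 ?normal_pdf_ge0.
have : (r%:E + k%:E * \int[lebesgue_measure]_x (x ^+ 2 * normal_pdf 0 s x)%:E
   <= 1)%E.
  rewrite -(integral_normal_pdf 0 (s / r)).
  rewrite -[r%:E]mule1 -(integral_normal_pdf 0 s).
  rewrite -!ge0_integralZl//; try by [rewrite lee_fin ltW|
    move=> ? _; rewrite lee_fin ?normal_pdf_ge0|apply/measurable_EFinP].
  rewrite -ge0_integralD//; first last.
  - by apply/measurable_EFinP/measurable_funM.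
  - by move=> x _; rewrite -EFinM lee_fin mulr_ge0// ltW.
  - by apply/measurable_EFinP/measurable_funM.
  - by move=> x _; rewrite -EFinM lee_fin mulr_ge0 ?normal_pdf_ge0// ltW.
  apply: ge0_le_integral => //=.
  - by move=> x _; rewrite lee_fin addr_ge0// mulr_ge0 ?normal_pdf_ge0// ltW.
  - by apply/measurable_EFinP/measurable_funD; exact: measurable_funM.
  - by move=> x _; rewrite -EFinM -EFinD lee_fin.
have : (0 <= \int[lebesgue_measure]_x (x ^+ 2 * normal_pdf 0 s x)%:E)%E.
  by apply: integral_ge0 => x _; rewrite lee_fin.
(* A finite moment [M] satisfies [r + k * M <= 1], that is [M <= (1 - r) / k]; the value [+oo]
   contradicts the bound 1 since [k > 0]. *)
case: (\int[lebesgue_measure]_x _)%E => [M| |]//.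
  rewrite -EFinM -EFinD !lee_fin => _ rkM.
  have -> : 2 * s ^+ 2 / (r * (1 + r)) = (1 - r) / k.
    rewrite /k; field.
    by rewrite !lt0r_neq0 ?subr_gt0 ?expr_lt1 ?addr_gt0// ltW.
  by rewrite ler_pdivlMr// mulrC lerBrDl.
by rewrite gt0_muley ?lte_fin// addey.
Qed.

(** The bound [2 * s ^+ 2 / (r * (1 + r))] tends to [s ^+ 2] as [r] tends to 1. The limit is
    replaced by a contradiction at one explicit [r]. *)
Lemma normal_second_moment_le (R : realType) (s : R) : 0 < s ->
  (\int[lebesgue_measure]_x (x ^+ 2 * normal_pdf 0 s x)%:E <= (s ^+ 2)%:E)%E.
Proof.
move=> s0; have := @normal_second_moment_le_scale R s _ s0.
have : (0 <= \int[lebesgue_measure]_x (x ^+ 2 * normal_pdf 0 s x)%:E)%E.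
  apply: integral_ge0 => x _; rewrite lee_fin.
  by rewrite mulr_ge0 ?sqr_ge0 ?normal_pdf_ge0.
case: (\int[lebesgue_measure]_x _)%E => [M| |]//; last first.
  (* Any [r] strictly between 0 and 1 gives a finite bound and so excludes [+oo]. *)
  by move=> _ /(_ 2^-1) /(_ ltac:(lra)).
rewrite !lee_fin => M0 scale; rewrite leNgt; apply/negP => sM.
have Mpos : 0 < M by apply: le_lt_trans sM; exact: sqr_ge0.
(* With [r = 1 - e], [r * (1 + r) = 2 - 3 * e + e ^+ 2]. Since [3 * e * M = M - s ^+ 2], the scaled
   bound becomes [M + e ^+ 2 * M <= s ^+ 2], against [s ^+ 2 < M]. *)
pose e := (M - s ^+ 2) / (3 * M).
have e0 : 0 < e by rewrite divr_gt0 ?subr_gt0 ?mulr_gt0.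
have e1 : e < 1.
  rewrite ltr_pdivrMr ?mulr_gt0//; have := sqr_ge0 s; lra.
have := scale (1 - e) ltac:(lra); rewrite lee_fin.
rewrite ler_pdivlMr; last by rewrite mulr_gt0; lra.
have eM : e * M = (M - s ^+ 2) / 3 by rewrite /e; field; exact: lt0r_neq0.
have := mulr_ge0 (sqr_ge0 e) M0.
nra.
Qed.

(** * Base-2 logarithm and differential entropy *)

Lemma log2e_EFin (R : realType) (x : R) :
  0 < x -> log2e x%:E = (ln x / ln 2)%:E.
Proof. by move=> x0; rewrite /log2e lne_EFin. Qed.

Lemma log2e0 (R : realType) : log2e (0 : \bar R) = -oo%E.
Proof.
by rewrite /log2e le0_lneNy// gt0_mulNye// lte_fin invr_gt0 ln_gt0// ltr1n.
Qed.

Lemma mule_log2e (R : realType) (x : R) :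
  0 <= x -> (x%:E * log2e x%:E)%E = (x * (ln x / ln 2))%:E.
Proof.
rewrite le0r => /orP[/eqP->|x0]; first by rewrite mul0e mul0r.
by rewrite log2e_EFin.
Qed.

(** Both functions have the same integral over every measurable set. This lets an arbitrary density
    of [X] be compared with [normal_pdf]. *)
Lemma density_unique (R : realType) (d : measure_display)
    (T : measurableType d) (P : probability T R) (X : {RV P >-> R})
    (f g : R -> R) :
  has_density P X f -> has_density P X g ->
  ae_eq lebesgue_measure setT (EFin \o f) (EFin \o g).
Proof.
move=> [mf f0 fX] [mg g0 gX].
apply: integral_ae_eq => //.
- apply/integrableP; split; first exact/measurable_EFinP.
  under eq_integral do rewrite /= ger0_norm//.
  by rewrite -fX// probability_setT ltry.
- exact/measurable_EFinP.
- by move=> E _ mE; rewrite -[LHS]fX// -[RHS]gX.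
Qed.

Lemma differential_entropy_ae_eq (R : realType) (f g : R -> R) :
  measurable_fun setT f -> measurable_fun setT g ->
  (forall x, 0 <= f x) -> (forall x, 0 <= g x) ->
  ae_eq lebesgue_measure setT (EFin \o f) (EFin \o g) ->
  differential_entropy f = differential_entropy g.
Proof.
move=> mf mg f0 g0 fg; rewrite /differential_entropy; congr (- _)%E.
have mlog (k : R -> R) : measurable_fun setT k -> (forall x, 0 <= k x) ->
    measurable_fun setT (fun x => (k x)%:E * log2e (k x)%:E)%E.
  move=> mk k0; under eq_fun do rewrite mule_log2e//.
  apply/measurable_EFinP/measurable_funM => //; apply: measurable_funM => //.
  by apply: measurableT_comp mk; exact: measurable_ln.
apply: ae_eq_integral => //; [exact: mlog|exact: mlog|].
by apply: filterS fg => x /(_ I)[fgx] _; rewrite fgx.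
Qed.

(** The negative log-density is quadratic, [a + b * x ^+ 2], so the entropy is [a] plus [b] times
    the second moment, which is at most [s ^+ 2]. *)
Lemma differential_entropy_normal_le (R : realType) (s : R) : 0 < s ->
  (differential_entropy (normal_pdf 0 s) <=
   (ln (Num.sqrt (2 * pi * expR 1) * s) / ln 2)%:E)%E.
Proof.
move=> s0; have ln2 : 0 < ln (2 : R) by rewrite ln_gt0// ltr1n.
pose a := - ln (normal_peak s) / ln 2; pose b := (2 * s ^+ 2 * ln 2)^-1.
have b0 : 0 < b by rewrite invr_gt0 !mulr_gt0// exprn_gt0.
have peak0 : 0 < normal_peak s by rewrite normal_peak_gt0// gt_eqF.
have p0 x : 0 < normal_pdf 0 s x.
  by rewrite normal_pdfE ?gt_eqF// mulr_gt0// expR_gt0.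
have plogp x : ((normal_pdf 0 s x)%:E * log2e (normal_pdf 0 s x)%:E =
    (- a)%:E * (normal_pdf 0 s x)%:E +
    (- b)%:E * (x ^+ 2 * normal_pdf 0 s x)%:E)%E.
  rewrite mule_log2e ?ltW// -!EFinM -EFinD; congr EFin.
  have -> : ln (normal_pdf 0 s x) = ln (normal_peak s) - x ^+ 2 / (2 * s ^+ 2).
    rewrite normal_pdfE ?gt_eqF// lnM ?posrE ?expR_gt0// expRK.
    by congr +%R; field; exact: lt0r_neq0.
  by rewrite /a /b; field; rewrite !lt0r_neq0.
have M0 : (0 <= \int[lebesgue_measure]_x (x ^+ 2 * normal_pdf 0 s x)%:E)%E.
  by apply: integral_ge0 => x _; rewrite lee_fin mulr_ge0 ?sqr_ge0// ltW.
have Mle := @normal_second_moment_le R s s0.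
have ix2 : lebesgue_measure.-integrable setT
    (fun x : R => (x ^+ 2 * normal_pdf 0 s x)%:E).
  apply/integrableP; split.
    apply/measurable_EFinP/measurable_funM; first exact: measurable_funX.
    exact: measurable_normal_pdf.
  under eq_integral => x _.
    rewrite gee0_abs; last by rewrite lee_fin mulr_ge0 ?sqr_ge0// ltW.
    over.
  exact: le_lt_trans Mle (ltry _).
have ip := @integrable_normal_pdf R 0 s.
rewrite /differential_entropy; under eq_integral do rewrite plogp.
rewrite integralD//=; [|exact: integrableZl|exact: integrableZl].
rewrite !integralZl// integral_normal_pdf mule1.
have [M ME] : exists M : R, (\int[lebesgue_measure]_x
    (x ^+ 2 * normal_pdf 0 s x)%:E = M%:E)%E.
  eexists; rewrite -[LHS]fineK// ge0_fin_numE//.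
  exact: le_lt_trans Mle (ltry _).
move: Mle; rewrite ME -EFinM -EFinD -EFinN !lee_fin => Mle.
(* Here [a] is the base-2 logarithm of [Num.sqrt (2 * pi) * s], and [b * s ^+ 2 = 1 / (2 * ln 2)] is
   that of the square root of e. *)
have -> : ln (Num.sqrt (2 * pi * expR 1) * s) / ln 2 = a + b * s ^+ 2.
  have pi0 := @pi_gt0 R.
  have e0 := @expR_gt0 R 1.
  rewrite /a /normal_peak lnV ?posrE ?sqrtr_gt0; last first.
    by rewrite mulrn_wgt0// mulr_gt0// exprn_gt0.
  have tpi0 : 0 < 2 * pi :> R by rewrite mulr_gt0.
  have -> : s ^+ 2 * pi *+ 2 = s ^+ 2 * (2 * pi) by ring.
  rewrite (sqrtrM _ (sqr_ge0 s)) sqrtr_sqr gtr0_norm// (sqrtrM _ (ltW tpi0)).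
  rewrite !lnM ?posrE ?mulr_gt0 ?sqrtr_gt0//.
  have -> : ln (Num.sqrt (expR 1)) = 2^-1 :> R.
    have : 2 * ln (Num.sqrt (expR 1)) = 1 :> R.
      by rewrite mulr_natl -lnXn ?sqrtr_gt0// sqr_sqrtr ?expR_ge0// expRK.
    lra.
  by rewrite /b; field; rewrite !lt0r_neq0.
by rewrite opprD mulNr !opprK lerD2l ler_pM2l.
Qed.

(** * Volume of the typical set *)

(** A vanishing product has logarithm [-oo], which stays infinite after multiplication by
    [n%:R^-1 > 0]; elsewhere the logarithm is real. This form makes measurability accessible. *)
Lemma typical_setE (R : realType) (f : R -> R) (n : nat) (B h : R) :
  (0 < n)%N -> (forall x, 0 <= f x) -> differential_entropy f = h%:E ->
  typical_set f n B = [set t | 0 < \prod_(i < n) f (tnth t i)] `&`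
    [set t |
      `|- (n%:R^-1 * (ln (\prod_(i < n) f (tnth t i)) / ln 2)) - h| <= B].
Proof.
move=> n0 f0 fh; rewrite /typical_set fh; apply/seteqP; split => t /=.
  have : 0 <= \prod_(i < n) f (tnth t i) by apply: prodr_ge0.
  rewrite le0r => /orP[/eqP->|p0].
    by rewrite log2e0 gt0_muleNy// lte_fin invr_gt0 ltr0n.
  by rewrite log2e_EFin.
by case=> p0; rewrite log2e_EFin.
Qed.

(** A sum with an infinite term is infinite in [\bar R], even [+oo - +oo], so no point is within [B]
    of the entropy. *)
Lemma typical_set_infinite_entropy (R : realType) (f : R -> R) (n : nat)
    (B : R) :
  differential_entropy f \isn't a fin_num -> typical_set f n B = set0.
Proof.
rewrite fin_numE negb_and !negbK /typical_set.
by case/orP=> /eqP ->; apply/seteqP; split => t //=; case: (- _)%E.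
Qed.

Lemma volume_typical_set_le (R : realType) (f : R -> R) (n : nat) (B H : R) :
  (0 < n)%N -> measurable_fun setT f -> (forall x, 0 <= f x) ->
  (\int[lebesgue_measure]_x (f x)%:E = 1)%E ->
  (differential_entropy f <= H%:E)%E ->
  (lebesgue_measure_tuple R n (typical_set f n B) <=
   (expR (n%:R * ((B + H) * ln 2)))%:E)%E.
Proof.
move=> n0 mf f0 f1.
have [hfin|hinf] := boolP (differential_entropy f \is a fin_num); last first.
  by rewrite typical_set_infinite_entropy// measure0 lee_fin expR_ge0.
have ln2 : 0 < ln (2 : R) by rewrite ln_gt0// ltr1n.
rewrite -(fineK hfin) lee_fin; set h := fine _ => hH.
rewrite (@typical_setE _ _ _ _ h)//; last by rewrite fineK.
set A := _ `&` _; set E := n%:R * _.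
have mp := @measurable_tuple_prod R f n mf.
have mA : measurable (A : set (n.-tuple (measurableTypeR R))).
  have mpreimage (g : n.-tuple (measurableTypeR R) -> R) (i : interval R) :
      measurable_fun setT g -> measurable (g @^-1` [set` i]).
    by move=> mg; rewrite -[X in measurable X]setTI; apply: mg.
  apply: measurableI.
    rewrite (_ : mkset _ =
        (fun t => \prod_(i < n) f (tnth t i)) @^-1` `]0, +oo[).
      exact: mpreimage.
    by apply/seteqP; split => t /=; rewrite in_itv/= andbT.
  rewrite (_ : mkset _ = (fun t =>
      `|- (n%:R^-1 * (ln (\prod_(i < n) f (tnth t i)) / ln 2)) - h|)
      @^-1` `]-oo, B]).
    apply: mpreimage; apply: measurableT_comp => //.
    apply: measurable_funB => //; apply: measurableT_comp => //.
    apply: measurable_funM => //; apply: measurable_funM => //.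
    by apply: measurableT_comp mp; exact: measurable_ln.
  by apply/seteqP; split => t /=; rewrite in_itv.
have pf0 (t : n.-tuple (measurableTypeR R)) : 0 <= \prod_(i < n) f (tnth t i).
  by apply: prodr_ge0.
have := @mule_measure_le_integral _ _ _ (lebesgue_measure_tuple R n) A
  _ (expR (- E)) mA mp pf0 (expR_ge0 _).
rewrite integral_tuple_prod// f1 -EFin_expe expr1n => vol.
rewrite -[leRHS]mule1 -lee_pdivrMl ?expR_gt0// -expRN.
(* The upper half of the absolute value bounds minus the base-2 logarithm of the product by
   [n * (B + h)], hence by [n * (B + H)]. *)
apply: vol => t [/= p0 /ler_normlP[_ +]].
rewrite -[X in _ -> _ <= X]lnK ?posrE// ler_expR /E.
set L := ln _ => LB; have n0R : 0 < n%:R :> R by rewrite ltr0n.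
have -> : L = - (n%:R * (- (n%:R^-1 * (L / ln 2)) * ln 2)).
  by field; rewrite !lt0r_neq0.
rewrite lerN2 !ler_pM2l// ler_pM2r//; lra.
Qed.

Theorem proposition3p16 (R : realType) (d : measure_display)
    (T : measurableType d) (P : probability T R) (X : {RV P >-> R})
    (f : R -> R) (sigma eta epsilon : R) (n : nat)
    (hsigma : 0 < sigma) (heta : 0 <= eta) (hepsilon : 0 < epsilon)
    (hn : (1 <= n)%N)
    (hX : forall A : set R, measurable A ->
       distribution P X A = normal_prob 0 sigma A)
    (hf : has_density P X f) :
  let B := eta ^+ 2 / (2 * sigma ^+ 2) + Num.sqrt (2 / pi) * (eta / sigma)
           + (1 + 1 / (2 * n%:R * sigma ^+ 2)) * epsilon in
  (lebesgue_measure_tuple R n (typical_set f n B)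
   <= ((2 `^ (eta ^+ 2 / (2 * sigma ^+ 2) + Num.sqrt (2 / pi) * (eta / sigma)
              + (2 * n%:R * sigma ^+ 2 + 1) / (2 * n%:R * sigma ^+ 2) * epsilon)
        * Num.sqrt (2 * pi * expR 1) * sigma) ^+ n)%:E)%E.
Proof.
lazy zeta; set B := (X in typical_set _ _ X); have [mf f0 fX] := hf.
(* [normal_prob] is by definition the integral of [normal_pdf], so [hX] is the density identity
   itself. *)
have normal_density : has_density P X (normal_pdf 0 sigma).
  split => //; [exact: measurable_normal_pdf|].
  by move=> x; rewrite normal_pdf_ge0.
pose H := ln (Num.sqrt (2 * pi * expR 1) * sigma) / ln 2.
have entropy_le : (differential_entropy f <= H%:E)%E.
  rewrite (differential_entropy_ae_eq _ _ (normal_pdf 0 sigma))//.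
  - exact: differential_entropy_normal_le.
  - exact: measurable_normal_pdf.
  - exact: normal_pdf_ge0.
  - exact: density_unique hf normal_density.
have f1 : (\int[lebesgue_measure]_x (f x)%:E = 1)%E.
  by rewrite -fX// probability_setT.
apply: (le_trans (@volume_typical_set_le R f n B H hn mf f0 f1 entropy_le)).
have ln2 : 0 < ln (2 : R) by rewrite ln_gt0// ltr1n.
rewrite lee_fin.
have -> : (2 * n%:R * sigma ^+ 2 + 1) / (2 * n%:R * sigma ^+ 2) =
    1 + 1 / (2 * n%:R * sigma ^+ 2) :> R.
  by rewrite mulrDl divff// !mulf_neq0// ?pnatr_eq0 ?lt0n_neq0//
    ?expf_neq0 ?gt_eqF.
have K0 : 0 < Num.sqrt (2 * pi * expR 1) * sigma.
  by rewrite mulr_gt0// sqrtr_gt0 !mulr_gt0 ?pi_gt0 ?expR_gt0.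
(* [H * ln 2] is the natural logarithm of the factor in [K0], so the exponential splits into that
   factor times [expR (B * ln 2)], which is what the power of 2 unfolds to. *)
rewrite -/B -mulrA expRM_natl mulrDl expRD divfK ?gt_eqF// lnK ?posrE//.
by rewrite /powR pnatr_eq0.
Qed.
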